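(* Let $\Gamma$ be a connected strongly regular graph with vertex set $X$. Then $\Gamma$ is pseudo-vertex-transitive if and only if for every pair of vertices $x,y\in X$, the local graph $\Delta_1(x)$ and the local graph $\Delta_1(y)$ have the same spectrum (the same multiset of adjacency eigenvalues).
   Context: A strongly regular graph with parameters $(n,k,a,c)$ is a $k$-regular graph on $n$ vertices in which every pair of adjacent vertices has exactly $a$ common neighbours and every pair of distinct non-adjacent vertices has exactly $c$ common neighbours. Let $\Gamma$ have vertex set $X$, path-length distance $\partial$ and diameter $D$. For $x\in X$ and $0\le i\le D$ let $\Delta_i(x)$ be the subgraph induced on $\{y\in X:\partial(x,y)=i\}$; $\Delta_1(x)$ is the local graph at $x$. Let $V=\mathbb{C}^X$, $A$ the adjacency matrix, and $E^*_i(x)$ the diagonal matrix with $(E^*_i(x))_{yy}=1$ if $\partial(x,y)=i$ and $0$ otherwise. The Terwilliger algebra $T(x)$ is the subalgebra of $\mathrm{Mat}_X(\mathbb{C})$ generated by $A,E^*_0(x),\dots,E^*_D(x)$. The graph $\Gamma$ is pseudo-vertex-transitive if for all $x,y\in X$: (i) there is a $\mathbb{C}$-algebra isomorphism $T(x)\to T(y)$ sending $A\mapsto A$ and $E^*_i(x)\mapsto E^*_i(y)$ for all $0\le i\le D$; and (ii) there is a $\mathbb{C}$-linear bijection $\rho:V\to V$ with $\rho A=A\rho$ and $\rho E^*_i(x)=E^*_i(y)\rho$ for all $0\le i\le D$. *)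

(* Defs.v *)
(* The complex field C is modelled as R[i] = complex R for an
   arbitrary R : realType (any realType is a complete archimedean ordered
   field, i.e. a copy of the reals, so R[i] is a copy of the complex numbers). *)
From HB Require Import structures.
From mathcomp Require Import all_boot all_order all_algebra.
From mathcomp Require Import reals complex.
Set Implicit Arguments. Unset Strict Implicit. Unset Printing Implicit Defensive.
Import Order.TTheory GRing.Theory Num.Theory.
Local Open Scope ring_scope.

Section Graphs.
Variable n : nat.
Implicit Types (e : rel 'I_n) (x y : 'I_n).

Definition simple_graph e := symmetric e /\ irreflexive e.

Definition nbhd e x : {set 'I_n} := [set y | e x y].

Definition srg_params e (k a c : nat) :=
  [/\ forall x, #|nbhd e x| = k,
      forall x y, e x y -> #|nbhd e x :&: nbhd e y| = a
    & forall x y, x != y -> ~~ e x y -> #|nbhd e x :&: nbhd e y| = c].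

Definition is_srg e := simple_graph e /\ exists k a c, srg_params e k a c.

Definition connected_graph e := forall x y, connect e x y.

Fixpoint ball e (m : nat) x : {set 'I_n} :=
  match m with
  | 0 => [set x]
  | m'.+1 => ball e m' x :|: [set z | [exists y in ball e m' x, e y z]]
  end.

(* path-length distance: the least m with y in ball e m x (every finite
   distance is < n; value n if y is unreachable, which does not happen
   for connected graphs) *)
Definition gdist e x y : nat := find (fun m => y \in ball e m x) (iota 0 n).

Definition diameter e : nat := \max_(x : 'I_n) \max_(y : 'I_n) gdist e x y.

Variable C : fieldType.

Definition adjmx e : 'M[C]_n := \matrix_(y, z) (e y z)%:R.

Definition dual_idem e x (i : nat) : 'M[C]_n :=
  \matrix_(y, z) ((y == z) && (gdist e x y == i))%:R.

Inductive gen_alg (G : 'M[C]_n -> Prop) : 'M[C]_n -> Prop :=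
  | gen_alg_gen M : G M -> gen_alg G M
  | gen_alg_one : gen_alg G 1%:M
  | gen_alg_add M N : gen_alg G M -> gen_alg G N -> gen_alg G (M + N)
  | gen_alg_scale (c : C) M : gen_alg G M -> gen_alg G (c *: M)
  | gen_alg_mul M N : gen_alg G M -> gen_alg G N -> gen_alg G (M *m N).

Definition terwilliger e x : 'M[C]_n -> Prop :=
  gen_alg (fun M => M = adjmx e \/
                    exists2 i, (i <= diameter e)%N & M = dual_idem e x i).

Definition terwilliger_iso e x y :=
  exists phi : 'M[C]_n -> 'M[C]_n,
  [/\ (forall M, terwilliger e x M -> terwilliger e y (phi M)),
      (forall M N, terwilliger e x M -> terwilliger e x N -> phi (M + N) = phi M + phi N),
      (forall (c : C) M, terwilliger e x M -> phi (c *: M) = c *: phi M),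
      (forall M N, terwilliger e x M -> terwilliger e x N -> phi (M *m N) = phi M *m phi N)
    & phi 1%:M = 1%:M ] /\
  [/\ (forall M N, terwilliger e x M -> terwilliger e x N -> phi M = phi N -> M = N),
      (forall N, terwilliger e y N -> exists2 M, terwilliger e x M & phi M = N),
      phi (adjmx e) = adjmx e
    & forall i, (i <= diameter e)%N -> phi (dual_idem e x i) = dual_idem e y i].

Definition module_iso e x y :=
  exists2 P : 'M[C]_n, P \in unitmx &
    P *m adjmx e = adjmx e *m P /\
    forall i, (i <= diameter e)%N -> P *m dual_idem e x i = dual_idem e y i *m P.

Definition pseudo_vertex_transitive e :=
  forall x y, terwilliger_iso e x y /\ module_iso e x y.

Definition local_adj e x : 'M[C]_#|nbhd e x| :=
  \matrix_(i, j) (e (enum_val i) (enum_val j))%:R.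

End Graphs.

Definition spectrum (C : fieldType) (m : nat) (M : 'M[C]_m) : C -> nat :=
  fun lambda => mup lambda (char_poly M).

Definition same_spectrum (C : fieldType) (m1 m2 : nat)
  (M1 : 'M[C]_m1) (M2 : 'M[C]_m2) := forall lambda, spectrum M1 lambda = spectrum M2 lambda.

(* Main.v *)
(** Two vertices with cospectral local graphs are matched as follows. The local
    graphs are regular Hermitian matrices with the same characteristic
    polynomial, so some unitary U conjugates one into the other and fixes the
    all-ones vector. Let G_x be the 0-1 matrix whose rows are the unit vectors
    of the closed neighbourhood of x. For M = A, I, J the Gram matrices
    G_x M G_x^* and G_y M G_y^* are conjugate under diag(1, U), and the span of
    A, I, J contains the algebra generated by A, so the same holds for every spectral
    projection M of A. On each eigenspace of A, equality of Gram matrices lets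
    us carry the rows of G_x to those of diag(1, U) G_y and extend by any
    bijection of the orthogonal complements, which have equal dimension. The
    resulting P commutes with A and intertwines the dual idempotents, because a
    connected strongly regular graph has diameter at most 2. Conjugation by P is
    then the isomorphism of Terwilliger algebras. Conversely, compressing an
    intertwiner P to the neighbourhoods conjugates the local graphs. *)
Require Import Defs.
From HB Require Import structures.
From mathcomp Require Import all_boot all_order all_algebra.
From mathcomp Require Import reals complex.
From mathcomp Require Import fingroup perm boolp spectral ring.
Import Order.TTheory GRing.Theory Num.Theory.
Local Open Scope ring_scope.
Local Open Scope sesquilinear_scope.
Set Implicit Arguments.
Unset Strict Implicit.
Unset Printing Implicit Defensive.

(** * Hermitian linear algebra: Gram matrices, spectral idempotents, unitary similarity *)

Section ConjugateTranspose.
Variable C : numClosedFieldType.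

Lemma trmxC_mul m n p (A : 'M[C]_(m, n)) (B : 'M[C]_(n, p)) :
  (A *m B)^t* = B^t* *m A^t*.
Proof. by rewrite trmx_mul map_mxM. Qed.

Lemma trmxC1 n : (1%:M : 'M[C]_n)^t* = 1%:M.
Proof. by rewrite trmx1 map_mx1. Qed.

Lemma mulmx_trmxC_eq0 m n (A : 'M[C]_(m, n)) : A *m A^t* = 0 -> A = 0.
Proof.
move=> AA0; apply/matrixP => i j; rewrite [RHS]mxE.
have := congr1 (fun M : 'M[C]_m => M i i) AA0; rewrite !mxE => /eqP.
under eq_bigr => l _ do rewrite !mxE -normCK.
rewrite psumr_eq0 => [/allP/(_ j)|l _]; last exact: exprn_ge0.
by rewrite mem_index_enum => /(_ isT); rewrite sqrf_eq0 normr_eq0 => /eqP.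
Qed.

Lemma gram_mul_eq0 l m n (W : 'M[C]_(l, m)) (G : 'M[C]_(m, n)) :
  W *m G *m G^t* = 0 -> W *m G = 0.
Proof.
by move=> WGG0; apply: mulmx_trmxC_eq0; rewrite trmxC_mul mulmxA WGG0 mul0mx.
Qed.

(** The left kernel of a matrix is that of its Gram matrix, because [W G G^* = 0] forces [W G] to
    have zero norm. *)
Lemma gram_kermx_sub m n (G H : 'M[C]_(m, n)) :
  G *m G^t* = H *m H^t* -> (kermx G <= kermx H)%MS.
Proof.
move=> eqGH; apply/sub_kermxP; apply: gram_mul_eq0.
by rewrite -mulmxA -eqGH mulmxA mulmx_ker mul0mx.
Qed.

Lemma gram_rank m n (G H : 'M[C]_(m, n)) :
  G *m G^t* = H *m H^t* -> \rank G = \rank H.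
Proof.
move=> eqGH; have : \rank (kermx G) = \rank (kermx H).
  by apply/eqP; rewrite eqn_leq !mxrankS ?gram_kermx_sub.
rewrite !mxrank_ker => eqr.
by rewrite -(subKn (rank_leq_row G)) eqr subKn ?rank_leq_row.
Qed.

(* A basis of the orthogonal complement of the row space of G, padded with zero
   rows to height n: its left kernel depends only on the rank of G. *)
Definition orthobase m n (G : 'M[C]_(m, n)) : 'M[C]_n :=
  pid_mx (n - \rank G) *m row_ebase (kermx (G^t*)).

Lemma rank_trmxC m n (G : 'M[C]_(m, n)) : \rank (G^t*) = \rank G.
Proof. by rewrite mxrank_map mxrank_tr. Qed.

Lemma orthobase_kermx m n (G : 'M[C]_(m, n)) :
  col_ebase (kermx (G^t*)) *m orthobase G = kermx (G^t*).
Proof.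
by rewrite mulmxA -[RHS]mulmx_ebase mxrank_ker rank_trmxC.
Qed.

Lemma orthobase_mul m n (G : 'M[C]_(m, n)) : orthobase G *m G^t* = 0.
Proof.
apply: (can_inj (mulKmx (col_ebase_unit (kermx (G^t*))))).
by rewrite mulmx0 mulmxA orthobase_kermx mulmx_ker.
Qed.

(** A column [z] killed by both blocks has [z^*] orthogonal to the rows of [G], hence in the row
    span of [orthobase G], so [z^* z = 0]. *)
Lemma col_orthobase_full m n (G : 'M[C]_(m, n)) : row_full (col_mx G (orthobase G)).
Proof.
rewrite -cokermx_eq0; set Z := cokermx _.
have : col_mx G (orthobase G) *m Z = 0 by exact: mulmx_coker.
rewrite mul_col_mx -[0]vsubmxK => /eq_col_mx[]; rewrite !linear0 => GZ NZ.
have /submxP[W ZW] : (Z^t* <= kermx (G^t*))%MS.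
  by apply/sub_kermxP; rewrite -trmxC_mul GZ trmx0 map_mx0.
have : Z^t* *m Z^t*^t* = 0.
  by rewrite trmxCK ZW -orthobase_kermx -(mulmxA W) -(mulmxA (col_ebase _)) NZ !mulmx0.
by move/mulmx_trmxC_eq0 => /(congr1 (fun M => M^t*)); rewrite trmxCK trmx0 map_mx0 => ->.
Qed.

(** Equal Gram matrices mean that the rows of [G] and of [H] satisfy the same linear relations.
    Adjoining complement bases of equal rank makes both systems span the whole space, which
    determines [P]. *)
Lemma gram_extension m n (G H : 'M[C]_(m, n)) :
  G *m G^t* = H *m H^t* ->
  exists2 P : 'M[C]_n, P \in unitmx & G *m P = H /\ P *m H^t* = G^t*.
Proof.
move=> eqGH; set X := col_mx G (orthobase G); set Y := col_mx H (orthobase H).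
have fullX : row_full X by exact: col_orthobase_full.
have fullY : row_full Y by exact: col_orthobase_full.
have kerXY : (kermx X <= kermx Y)%MS.
  apply/sub_kermxP; have := mulmx_ker X.
  rewrite -[kermx X]hsubmxK; set U := lsubmx _; set V := rsubmx _.
  rewrite !mul_row_col => UV0.
  have UG0 : U *m G = 0.
    apply: gram_mul_eq0; have := congr1 (mulmx^~ (G^t*)) UV0.
    by rewrite mulmxDl -(mulmxA V) orthobase_mul mulmx0 addr0 mul0mx.
  have UH0 : U *m H = 0.
    by apply: gram_mul_eq0; rewrite -mulmxA -eqGH mulmxA UG0 mul0mx.
  move: UV0; rewrite UG0 UH0 !add0r !mulmxA => VN0.
  (* Cancelling the invertible [row_ebase] leaves [V] times a [pid_mx], which depends only on the
     rank shared by [G] and [H]. *)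
  have := congr1 (mulmx^~ (invmx (row_ebase (kermx (G^t*))))) VN0.
  rewrite mulmxK ?row_ebase_unit // mul0mx (gram_rank eqGH) => ->.
  by rewrite mul0mx.
pose P := pinvmx X *m Y.
(* The rows of [X *m pinvmx X - 1] are relations between the rows of [X], hence between those of
   [Y]. *)
have XP : X *m P = Y.
  apply/eqP; rewrite -subr_eq0 mulmxA -{2}[Y]mul1mx -mulmxBl; apply/eqP.
  apply/sub_kermxP/(submx_trans _ kerXY)/sub_kermxP.
  by rewrite mulmxBl mul1mx mulmxKpV ?subrr.
exists P.
  rewrite -row_full_unit -col_leq_rank; apply: leq_trans (mxrankM_maxr X P).
  by rewrite XP col_leq_rank.
split; first by have := congr1 usubmx XP; rewrite mul_col_mx !col_mxKu.
apply: (row_full_inj fullX); rewrite mulmxA XP !mul_col_mx eqGH.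
by rewrite !orthobase_mul.
Qed.

(* The extension fixes the range of 1 - E because 1 - E is adjoined to both G E
   and H E. *)
Lemma gram_extension_idem m n (E : 'M[C]_n) (G H : 'M[C]_(m, n)) :
  E^t* = E -> E *m E = E -> G *m E *m G^t* = H *m E *m H^t* ->
  exists P : 'M[C]_n,
    [/\ P \in unitmx, P *m E = E *m P, G *m E *m P = H *m E & P *m E *m H^t* = E *m G^t*].
Proof.
move=> Estar EE eqGH; pose F := 1%:M - E.
have Fstar : F^t* = F by rewrite /F linearB /= map_mxB trmxC1 Estar.
have EF : E *m F = 0 by rewrite mulmxBr mulmx1 EE subrr.
have FE : F *m E = 0 by rewrite mulmxBl mul1mx EE subrr.
have FF : F *m F = F by rewrite {1}/F mulmxBl mul1mx EF subr0.
have gramE (K : 'M[C]_(m, n)) : col_mx (K *m E) F *m (col_mx (K *m E) F)^t* =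
    block_mx (K *m E *m K^t*) 0 0 F.
  rewrite tr_col_mx map_row_mx mul_col_row Fstar trmxC_mul Estar.
  by rewrite !mulmxA -!(mulmxA K) FE EF EE FF !mulmx0 mul0mx.
have [|P Pu [GP PH]] := @gram_extension _ _ (col_mx (G *m E) F) (col_mx (H *m E) F).
  by rewrite !gramE eqGH.
move: GP PH; rewrite mul_col_mx => /eq_col_mx[GP FP].
rewrite !tr_col_mx !map_row_mx mul_mx_row Fstar !trmxC_mul Estar.
move=> /eq_row_mx[PH PF]; exists P; split=> //; last by rewrite -mulmxA.
have := etrans PF (esym FP).
by rewrite mulmxBl mulmxBr mul1mx mulmx1 => /addrI/oppr_inj.
Qed.

(** [E t] is [Q^* diag(d_t) Q], where the unitary [Q] diagonalises [A] and [d_t] marks the diagonal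
    positions with value [t]. It vanishes when [t] is no eigenvalue, so the identities hold for
    every [t]. *)
Lemma hermitian_spectral_idempotents n (A : 'M[C]_n) : A^t* = A ->
  exists (s : seq C) (E : C -> 'M[C]_n),
    [/\ uniq s, \sum_(t <- s) E t = 1%:M,
        forall t u, E t *m E u = if t == u then E t else 0,
        forall t, (E t)^t* = E t &
        forall t, A *m E t = t *: E t /\ E t *m A = t *: E t].
Proof.
move=> Astar.
have /orthomx_spectralP : A \is normalmx by apply/normalmxP; rewrite Astar.
have := spectral_unitarymx A; set Q := spectralmx A; set D := spectral_diag A.
move=> Qunit; rewrite invmx_unitary // => AE.
have /unitarymxP QQ := Qunit; have QQ' := mulmx1C QQ.
pose d t : 'rV[C]_n := \row_i (D 0 i == t)%:R.
have Ds i : D 0 i \in undup (codom (D 0)) by rewrite mem_undup codom_f.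
exists (undup (codom (D 0))), (fun t => Q^t* *m diag_mx (d t) *m Q).
split=> [|||t|t]; first exact: undup_uniq.
- rewrite -mulmx_suml -mulmx_sumr -[RHS]QQ' -[in RHS](mulmx1 (Q^t*)).
  congr (_ *m _ *m _); rewrite -linear_sum /= -diag_const_mx; congr diag_mx.
  apply/rowP => i; rewrite summxE !mxE.
  under eq_bigr => t _ do rewrite mxE.
  rewrite (bigD1_seq (D 0 i)) ?undup_uniq //=.
  by rewrite eqxx big1 ?addr0 // => t; rewrite eq_sym => /negPf->.
- move=> t u; rewrite !mulmxA mulmxtVK // -(mulmxA (Q^t*)).
  rewrite mulmx_diag; case: eqP => [<-|/eqP tu].
    congr (_ *m diag_mx _ *m _); apply/rowP => i.
    by rewrite !mxE; case: eqP; rewrite ?mulr1 ?mulr0.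
  rewrite (_ : (\row_i _) = 0) ?linear0 ?mul0mx ?mulmx0 //.
  apply/rowP => i; rewrite !mxE; case: eqP => [->|_]; last by rewrite mul0r.
  by rewrite (negPf tu) mulr0.
- rewrite !trmxC_mul trmxCK mulmxA; congr (_ *m _ *m _).
  rewrite tr_diag_mx map_diag_mx; congr diag_mx; apply/rowP => i.
  by rewrite !mxE rmorph_nat.
- have DdE : diag_mx D *m diag_mx (d t) = t *: diag_mx (d t).
    rewrite mulmx_diag -linearZ; congr diag_mx; apply/rowP => i; rewrite !mxE.
    by case: eqP => [->|]; rewrite ?mulr0.
  rewrite AE !mulmxA !mulmxtVK //.
  rewrite -!(mulmxA (Q^t*) (diag_mx _)) (diag_mxC (d t)) DdE.
  by rewrite -scalemxAr -scalemxAl mulmxA.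
Qed.

(** [V] stands for a space of matrices containing the powers of [A]. The spectral idempotents are
    polynomials in [A], hence lie in it, and the maps found on the separate eigenspaces are
    glued. *)
Lemma gram_extension_comm m n (A : 'M[C]_n) (G H : 'M[C]_(m, n))
    (V : 'M[C]_n -> Prop) :
  A^t* = A -> V 1%:M -> (forall M N, V M -> V N -> V (M + N)) ->
  (forall c M, V M -> V (c *: M)) -> (forall M, V M -> V (A *m M)) ->
  (forall M, V M -> G *m M *m G^t* = H *m M *m H^t*) ->
  exists2 P : 'M[C]_n, P \in unitmx &
    [/\ P *m A = A *m P, G *m P = H & P *m H^t* = G^t*].
Proof.
move=> Astar V1 VD VZ VA gramV.
have [s [E [s_uniq sumE EE Estar AE]]] := hermitian_spectral_idempotents Astar.
(* [B w] is the product of the [A - u] for [u] in [w], written with the closure operations of [V]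
   only. *)
pose B w := foldr (fun u M => A *m M - u *: M) 1%:M w.
have VB w : V (B w).
  elim: w => //= u w IH; apply: VD; first exact: VA.
  by rewrite -scaleNr; apply: VZ.
have BE w v : B w *m E v = (\prod_(u <- w) (v - u)) *: E v.
  elim: w => [|u w IH] /=; first by rewrite big_nil scale1r mul1mx.
  rewrite big_cons mulmxBl -mulmxA -scalemxAl IH -scalemxAr (AE v).1 !scalerA.
  by rewrite -scalerBl mulrBl [v * _]mulrC.
have gramE t : G *m E t *m G^t* = H *m E t *m H^t*.
  have [st|nst] := boolP (t \in s); last first.
    suff -> : E t = 0 by rewrite !mulmx0 !mul0mx.
    rewrite -[E t]mulmx1 -sumE mulmx_sumr big_seq big1 // => u su.
    by rewrite EE; case: eqP nst => [->|//]; rewrite su.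
  (* Lagrange interpolation: the product of [A - u] over the other eigenvalues kills the other
     eigenspaces and is a nonzero scalar on that of [t]. *)
  apply: gramV; suff -> : E t = (\prod_(u <- rem t s) (t - u))^-1 *: B (rem t s).
    exact: VZ.
  rewrite -[B _]mulmx1 -sumE mulmx_sumr [\sum_(u <- s) _](bigD1_seq t) //= BE.
  rewrite scalerDr scalerA.
  rewrite mulVf ?scale1r; last first.
    rewrite prodf_seq_neq0; apply/allP => u /=.
    by rewrite mem_rem_uniq // inE subr_eq0 eq_sym => /andP[].
  rewrite [X in _ + _ *: X]big_seq_cond [X in _ + _ *: X]big1 ?scaler0 ?addr0 //.
  move=> v /andP[sv vt].
  rewrite BE (big_rem v) /= ?subrr ?mul0r ?scale0r //.
  by rewrite mem_rem_uniq // inE vt.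
have EEt t : E t *m E t = E t by rewrite EE eqxx.
have [f fP] := choice (fun t => gram_extension_idem (Estar t) (EEt t) (gramE t)).
have fu t : f t \in unitmx by have [] := fP t.
have fE t : E t *m f t = f t *m E t by have [] := fP t.
(* Each [f t] commutes with [E t], so the sum acts as [f t] on the eigenspace of [t], and the
   inverses glue to an inverse. *)
pose P := \sum_(t <- s) E t *m f t.
exists P; last split.
- suff /mulmx1_unit[] : P *m (\sum_(t <- s) E t *m invmx (f t)) = 1%:M by [].
  rewrite -[RHS]sumE mulmx_suml; apply: eq_big_seq => t st.
  rewrite mulmx_sumr (bigD1_seq t) //= big1 => [|u].
    by rewrite addr0 fE mulmxA -(mulmxA (f t)) EE eqxx -fE mulmxK.
  by rewrite eq_sym => /negPf tu; rewrite fE mulmxA -(mulmxA (f t)) EE tu mulmx0 mul0mx.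
- rewrite mulmx_suml mulmx_sumr; apply: eq_bigr => t _.
  by rewrite {1}fE -mulmxA (AE t).2 mulmxA (AE t).1 -scalemxAr -scalemxAl fE.
- rewrite -[RHS]mulmx1 -sumE !mulmx_sumr; apply: eq_bigr => t _.
  by rewrite mulmxA; have [] := fP t.
- rewrite -[RHS]mul1mx -sumE !mulmx_suml; apply: eq_bigr => t _.
  by rewrite fE; have [] := fP t.
Qed.

(** [P] is rectangular because two neighbourhoods have sizes that are not convertible. A two-sided
    inverse forces equal sizes, and then [det P] cancels. *)
Lemma char_poly_intertwine m1 m2 (P : 'M[C]_(m1, m2)) (P' : 'M_(m2, m1)) M N :
  P *m P' = 1%:M -> P' *m P = 1%:M -> M *m P = P *m N ->
  char_poly M = char_poly N.
Proof.
move=> PP' P'P; have eq_m : m1 = m2.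
  by apply/eqP; rewrite eqn_leq (mulmx1_min PP') (mulmx1_min P'P).
case: m2 / eq_m => // in P P' N PP' P'P *; move=> MP.
pose Pp := map_mx (@polyC C) P; pose Pp' := map_mx (@polyC C) P'.
have PPp : Pp *m Pp' = 1%:M by rewrite -map_mxM PP' map_mx1.
have : char_poly_mx M *m Pp = Pp *m char_poly_mx N.
  by rewrite mulmxBl mulmxBr -!map_mxM MP mul_scalar_mx mul_mx_scalar.
move=> /(congr1 (fun K => \det (K *m Pp'))) /=.
rewrite -(mulmxA (char_poly_mx M)) PPp mulmx1 /char_poly => ->.
by rewrite !det_mulmx mulrAC -det_mulmx PPp det1 mul1r.
Qed.

(** Both matrices are unitarily diagonalisable, and equal characteristic polynomials make the
    diagonals agree up to a permutation. *)
Lemma normalmx_char_poly_similar m (M N : 'M[C]_m) :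
  M \is normalmx -> N \is normalmx -> char_poly M = char_poly N ->
  exists2 U : 'M[C]_m, U \is unitarymx & U *m N = M *m U.
Proof.
suff diagP (K : 'M[C]_m) : K \is normalmx -> exists (Q : 'M[C]_m) (d : 'rV[C]_m),
    [/\ Q \is unitarymx, Q *m K = diag_mx d *m Q &
        char_poly K = \prod_(x <- [tuple d 0 i | i < m]) ('X - x%:P)].
  move=> /diagP[Q [d [Qu QM ->]]] /diagP[R [f [Ru RN ->]]].
  move=> /prod_XsubC_eq/tuple_permP[s] /val_inj ds.
  have sK : perm_mx s \is @unitarymx C m m.
    by apply/unitarymxP; rewrite tr_perm_mx map_perm_mx -perm_mxM mulgV perm_mx1.
  have dfs : diag_mx d *m perm_mx s = perm_mx s *m diag_mx f.
    apply/matrixP => i j; rewrite mul_diag_mx mul_mx_diag !mxE.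
    have := congr1 (fun w => tnth w i) ds; rewrite /= !tnth_mktuple => ->.
    by case: eqP => [->|]; rewrite ?mulr1 ?mul1r ?mulr0 ?mul0r.
  exists (Q^t* *m perm_mx s *m R).
    by rewrite !mul_unitarymx ?trmxC_unitary.
  apply: (row_full_inj (A := Q)); first by rewrite row_full_unit unitarymx_unit.
  have QQ : Q *m Q^t* = 1%:M by exact/unitarymxP.
  by rewrite !mulmxA QM QQ mul1mx -!mulmxA RN (mulmxA Q) QQ mul1mx !mulmxA dfs.
move=> /orthomx_spectralP; have Ku := spectral_unitarymx K => KE.
exists (spectralmx K), (spectral_diag K).
have QK : spectralmx K *m K = diag_mx (spectral_diag K) *m spectralmx K.
  by rewrite {2}KE !mulmxA mulmxV ?unitarymx_unit // mul1mx.
split=> //.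
rewrite (@char_poly_intertwine _ _ (invmx (spectralmx K)) (spectralmx K) K
   (diag_mx (spectral_diag K))) ?mulVmx ?mulmxV ?unitarymx_unit //; last first.
  by rewrite {1}KE mulmxK ?unitarymx_unit.
rewrite char_poly_trig ?diag_mx_is_trig // big_tuple; apply: eq_bigr => i _.
by rewrite tnth_mktuple mxE eqxx.
Qed.

(** With [J] the all-ones matrix, [J L = a J] gives [((X - a) I - t J) (X I - L) = (X - a) (X I - L
    - t J)]; take determinants. The determinant on the right is independent of [L], so cospectrality
    survives adding [t J]. *)
Lemma char_poly_add_const m (a t : C) (L : 'M[C]_m) :
  const_mx 1 *m L = a *: (const_mx 1 : 'rV_m) ->
  char_poly (L + t *: const_mx 1) * ('X - a%:P) ^+ m =
  char_poly L * \det (('X - a%:P)%:M - t%:P *: const_mx 1 : 'M_m).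
Proof.
move=> rowL; rewrite mulrC -detZ [RHS]mulrC -det_mulmx; congr (\det _).
have JL : const_mx 1 *m map_mx polyC L = a%:P *: (const_mx 1 : 'M_m).
  apply/matrixP => i j; have := congr1 (fun v : 'rV_m => (v 0 j)%:P) rowL.
  rewrite !mxE !mulr1 => <-; rewrite rmorph_sum; apply: eq_bigr => l _.
  by rewrite !mxE !mul1r.
rewrite /char_poly_mx map_mxD map_mxZ map_const_mx mulmxBl mul_scalar_mx.
rewrite mulmxBr -!scalemxAl JL mul_mx_scalar opprD addrA scalerBr.
by rewrite !scalerA -scalerBl -mulrBr [t%:P * _]mulrC rmorph1.
Qed.

Lemma regular_cospectral_unitary m1 m2 (a : C) (L1 : 'M[C]_m1) (L2 : 'M[C]_m2) :
  m1 = m2 -> L1^t* = L1 -> L2^t* = L2 ->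
  const_mx 1 *m L1 = a *: (const_mx 1 : 'rV_m1) ->
  const_mx 1 *m L2 = a *: (const_mx 1 : 'rV_m2) ->
  char_poly L1 = char_poly L2 ->
  exists U : 'M[C]_(m1, m2),
    [/\ U *m U^t* = 1%:M, U^t* *m U = 1%:M, U *m L2 = L1 *m U &
       const_mx 1 *m U = (const_mx 1 : 'rV_m2)].
Proof.
move=> eq_m; case: m2 / eq_m L2; move: m1 L1 => m L1 L2.
have [m0|m_gt0] := posnP m.
  have no_ord (i : 'I_m) : False.
    by have := leq_ltn_trans (leq0n i) (ltn_ord i); rewrite {1}m0.
  move=> *; exists 1%:M; split; rewrite ?trmxC1 ?mulmx1 //.
  by apply/matrixP => i; case: (no_ord i).
move=> L1star L2star row1 row2 eq12; set u := const_mx 1 : 'rV[C]_m.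
have mR0 : m%:R != 0 :> C by rewrite pnatr_eq0 -lt0n.
(* Adding t J to L2 moves the eigenvalue a of the all-ones vector to a + t m;
   for t generic this makes it simple, so that a unitary similarity between
   L1 + t J and L2 + t J fixes the all-ones vector up to a phase. *)
have [t /negP nroot] : exists t : nat, ~~ root (char_poly L2) (a + t%:R * m%:R).
  pose r := [seq a + t%:R * m%:R | t <- iota 0 (size (char_poly L2))].
  have : ~~ all (root (char_poly L2)) r.
    apply/negP => /(max_poly_roots (monic_neq0 (char_poly_monic L2))).
    rewrite size_map size_iota ltnn map_inj_uniq ?iota_uniq => [/(_ isT)//|t1 t2].
    by move/addrI/(mulIf mR0)/eqP; rewrite eqr_nat => /eqP.
  by case/allPn => _ /mapP[t _ ->]; exists t.
pose J : 'M[C]_m := const_mx 1.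
have uJ : u *m J = m%:R *: u.
  apply/matrixP => i j; rewrite !mxE; under eq_bigr => l _ do rewrite !mxE mulr1.
  by rewrite sumr_const card_ord mulr1.
have Jstar : J^t* = J by apply/matrixP => i j; rewrite !mxE rmorph1.
have normalL L : L^t* = L -> L + t%:R *: J \is normalmx.
  move=> Lstar; apply/normalmxP; suff -> : (L + t%:R *: J)^t* = L + t%:R *: J by [].
  by rewrite linearD linearZ /= map_mxD map_mxZ rmorph_nat Lstar Jstar.
have [] := normalmx_char_poly_similar (normalL _ L1star) (normalL _ L2star).
  have X0 : ('X - a%:P) ^+ m != 0 by rewrite expf_neq0 ?polyXsubC_eq0.
  by apply: (mulIf X0); rewrite !char_poly_add_const // eq12.
move=> U /unitarymxP UU UL.
set v := u *m U.
have vL : v *m (L2 + t%:R *: J) = (a + t%:R * m%:R) *: v.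
  by rewrite -mulmxA UL mulmxA mulmxDr row1 -scalemxAr uJ scalerA -scalerDl -scalemxAl.
(* [b] is the mean of the entries of [v], so that [J] annihilates [v - b *: u]. *)
pose b := (\sum_i v 0 i) / m%:R.
have vJ : v *m J = (m%:R * b) *: u.
  apply/rowP => i; rewrite !mxE mulr1 mulrC divfK //.
  by apply: eq_bigr => l _; rewrite !mxE mulr1.
(* Otherwise [v - b *: u] is an eigenvector of [L2] itself for [a + t m], which is not a root of its
   characteristic polynomial. *)
have vu : v = b *: u.
  apply/eqP; rewrite -subr_eq0; apply: contraT => w0; case: nroot.
  rewrite -eigenvalue_root_char; apply/eigenvalueP; exists (v - b *: u) => //.
  have vL2 : v *m L2 = (a + t%:R * m%:R) *: v - (t%:R * m%:R * b) *: u.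
    by rewrite -vL mulmxDr -scalemxAr vJ scalerA mulrA addrK.
  rewrite mulmxBl vL2 -scalemxAl row2 scalerBr !scalerA -addrA -opprD -scalerDl.
  by rewrite [b * a]mulrC -mulrDl [t%:R * _ + a]addrC.
have uu : u *m u^t* = m%:R%:M.
  apply/matrixP => i j; rewrite !mxE !ord1 eqxx.
  under eq_bigr => l _ do rewrite !mxE rmorph1 mulr1.
  by rewrite sumr_const card_ord.
(* [U] preserves the norm of [u], so the phase [b] has modulus 1 and can be divided out. *)
have bb : b * b^* = 1.
  have : v *m v^t* = m%:R%:M by rewrite trmxC_mul mulmxA mulmxtVK -?uu //; apply/unitarymxP.
  rewrite vu linearZ map_mxZ /= -scalemxAl -scalemxAr uu scalerA scale_scalar_mx.
  move/(congr1 (fun M : 'M_1 => M 0 0)).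
  by rewrite !mxE eqxx !mulr1n -[RHS]mul1r => /(mulIf mR0).
have b0 : b != 0 by apply: contra_eq_neq bb => ->; rewrite mul0r eq_sym oner_eq0.
have bUU : (b^-1 *: U) *m (b^-1 *: U)^t* = 1%:M.
  rewrite linearZ map_mxZ /= -scalemxAl -scalemxAr UU scalerA fmorphV -invfM bb invr1.
  by rewrite scale1r.
exists (b^-1 *: U); split=> //; first exact: mulmx1C.
- rewrite -scalemxAl -scalemxAr; congr (_ *: _).
  have JE : J = u^t* *m u.
    by apply/matrixP => i j; rewrite !mxE big_ord1 !mxE rmorph1 mulr1.
  (* Together with [u U = b u] this gives [U J = J U], so [J] cancels from the intertwining
     relation. *)
  have Uu : U *m u^t* = b *: u^t*.
    have : v^t* = U^t* *m u^t* by rewrite trmxC_mul.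
    rewrite vu linearZ map_mxZ /= => /(congr1 (fun M => b *: (U *m M))).
    by rewrite -scalemxAr scalerA bb scale1r mulmxA UU mul1mx.
  move: UL; rewrite mulmxDr mulmxDl -scalemxAr -scalemxAl JE mulmxA Uu -scalemxAl.
  by rewrite -(mulmxA _ u U) -/v vu -scalemxAr => /addIr.
- by rewrite -scalemxAr -/v vu scalerA mulVf ?scale1r.
Qed.

Lemma same_spectrum_char_poly m1 m2 (M : 'M[C]_m1) (N : 'M[C]_m2) :
  same_spectrum M N -> char_poly M = char_poly N.
Proof.
have [r Mr] := closed_field_poly_normal (char_poly M).
have [s Ns] := closed_field_poly_normal (char_poly N).
rewrite /same_spectrum /spectrum Mr Ns !(monicP (char_poly_monic _)) !scale1r => eqMN.
apply: perm_big; apply/allP => z _ /=; apply/eqP.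
by have := eqMN z; rewrite !mu_prod_XsubC.
Qed.
End ConjugateTranspose.

(** * Distances in a connected strongly regular graph *)

Section Distance.
Variables (n : nat) (e : rel 'I_n).
Implicit Types x y z : 'I_n.

Lemma gdist_le m x y : y \in ball e m x -> (gdist e x y <= m)%N.
Proof.
move=> ym; have [lt_mn|le_nm] := ltnP m n; last first.
  by apply: leq_trans (find_size _ _) _; rewrite size_iota.
rewrite leqNgt; apply/negP => /(before_find 0).
by rewrite nth_iota // add0n ym.
Qed.

(** The bound below [n] excludes the default value of [gdist], so the search has succeeded. *)
Lemma gdist_ball m x y : (gdist e x y <= m)%N -> (m < n)%N -> y \in ball e (gdist e x y) x.
Proof.
move=> le_m lt_mn; have lt_n := leq_ltn_trans le_m lt_mn.
have hasP : has (fun m => y \in ball e m x) (iota 0 n) by rewrite has_find size_iota.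
by have := nth_find 0%N hasP; rewrite nth_iota.
Qed.

Lemma ballS m x y z : y \in ball e m x -> e y z -> z \in ball e m.+1 x.
Proof.
move=> ym eyz; rewrite /= in_setU [X in _ || X]inE; apply/orP; right.
by apply/existsP; exists y; rewrite ym.
Qed.

Lemma gdist_eq0 x y : (gdist e x y == 0%N) = (x == y).
Proof.
apply/idP/eqP => [d0|->]; last by rewrite -leqn0 gdist_le ?inE.
have /(_ 0%N) := @gdist_ball _ x y; rewrite leq_eqVlt d0 (eqP d0) inE.
by move=> /(_ isT (leq_ltn_trans (leq0n _) (ltn_ord x)))/eqP.
Qed.

Lemma gdist_eq1 x y : irreflexive e -> (gdist e x y == 1%N) = e x y.
Proof.
move=> irr_e; apply/idP/idP => [d1|exy].
  have xy : x != y by rewrite -gdist_eq0 (eqP d1).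
  have n_gt1 : (1 < n)%N.
    by rewrite -[n]card_ord; apply/card_gt1P; exists x, y.
  have := gdist_ball (eq_leq (eqP d1)) n_gt1.
  rewrite (eqP d1) !inE eq_sym (negPf xy) /= => /existsP[z].
  by rewrite inE => /andP[/eqP->].
have le1 : (gdist e x y <= 1)%N.
  by apply/gdist_le/(ballS (y := x)); rewrite ?inE.
rewrite eqn_leq le1 lt0n gdist_eq0.
by apply: contraTneq exy => ->; rewrite irr_e.
Qed.

(** Distinct non-adjacent vertices have a common neighbour unless [c = 0]. In that case being equal
    or adjacent to [x] propagates along paths, and connectedness leaves no vertex non-adjacent to
    [x]. *)
Lemma srg_gdist_le2 x y : is_srg e -> connected_graph e -> (gdist e x y <= 2)%N.
Proof.
move=> [[sym_e irr_e] [k [a [c [_ _ eq_c]]]]] conn_e.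
have [->|xy] := eqVneq x y; first by rewrite gdist_le // !inE eqxx.
have [exy|nexy] := boolP (e x y).
  by have := exy; rewrite -(gdist_eq1 x y irr_e) => /eqP->.
have c_gt0 : (0 < c)%N.
  rewrite lt0n; apply: contraNneq nexy => c0.
  have near z : connect e x z -> (x == z) || e x z.
    case/connectP => p; elim/last_ind: p z => [|p u IH] z.
      by move=> _ ->; rewrite eqxx.
    rewrite rcons_path last_rcons => /andP[/IH/(_ erefl) nearw ewu ->].
    have [//|xu] := eqVneq x u; case/orP: nearw => [/eqP-> //|exw].
    apply: contraT => nexu; have := eq_c _ _ xu nexu; rewrite c0 => /eqP.
    rewrite cards_eq0 => /eqP/setP/(_ (last x p)).
    by rewrite !inE exw sym_e ewu.
  by have := near y (conn_e x y); rewrite (negPf xy).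
have /card_gt0P[z] : (0 < #|nbhd e x :&: nbhd e y|)%N by rewrite eq_c.
rewrite !inE => /andP[exz eyz].
apply/gdist_le/(ballS (y := z)); last by rewrite sym_e.
by apply: (ballS (y := x)) => //; rewrite inE.
Qed.

Lemma diameter_gt0 x y : x != y -> (0 < diameter e)%N.
Proof.
rewrite -gdist_eq0 -lt0n => /leq_trans; apply.
apply: leq_trans (leq_bigmax (F := fun x => \max_y gdist e x y) x).
exact: (leq_bigmax (F := gdist e x)).
Qed.
End Distance.

(** * Dual idempotents, local graphs and the quadratic equation of [A] *)

Section Idempotents.
Variables (C : fieldType) (n : nat) (e : rel 'I_n).
Hypotheses (sym_e : symmetric e) (irr_e : irreflexive e).
Implicit Types x y : 'I_n.
Local Notation A := (adjmx C e).
Local Notation J := (const_mx 1 : 'M[C]_n).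

Definition nbhd_mx x : 'M[C]_(#|nbhd e x|, n) := rowsub enum_val 1%:M.
Local Notation S := nbhd_mx.

Lemma mul_nbhd_mx p x (M : 'M[C]_(n, p)) : S x *m M = rowsub enum_val M.
Proof. by rewrite mul_rowsub_mx mul1mx. Qed.

Lemma mul_mx_nbhdT p x (M : 'M[C]_(p, n)) : M *m (S x)^T = colsub enum_val M.
Proof. by rewrite trmx_mxsub trmx1 mulmx_colsub mulmx1. Qed.

Lemma nbhd_mxK x : S x *m (S x)^T = 1%:M.
Proof.
rewrite mul_mx_nbhdT; apply/matrixP => i j.
by rewrite !mxE (inj_eq enum_val_inj).
Qed.

Lemma nbhd_mx_adj x : S x *m A *m (S x)^T = local_adj C e x.
Proof.
by rewrite mul_mx_nbhdT mul_nbhd_mx; apply/matrixP => i j; rewrite !mxE.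
Qed.

Lemma sum_natr_card (T : finType) (P : pred T) :
  \sum_z (P z)%:R = #|P|%:R :> C.
Proof.
by rewrite -natr_sum -sum1_card [in RHS]big_mkcond.
Qed.

Lemma dual_idem0 x : dual_idem C e x 0 = delta_mx x x.
Proof.
apply/matrixP => i j; rewrite !mxE gdist_eq0 [x == i]eq_sym.
by have [->|] := eqVneq i x; rewrite ?andbF // andbT eq_sym.
Qed.

Lemma dual_idem1 x : dual_idem C e x 1 = (S x)^T *m S x.
Proof.
apply/matrixP => i j; rewrite !mxE gdist_eq1 //.
under eq_bigr => l _ do rewrite !mxE -natrM mulnb.
rewrite -(big_enum_val (A := mem (nbhd e x)) (fun z => ((z == i) && (z == j))%:R)) /=.
rewrite big_mkcond (bigD1 i) //= big1 => [|z /negPf->]; last by rewrite if_same.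
by rewrite eqxx inE addr0 andbC; case: (e x i) => //; rewrite andbF.
Qed.

Lemma dual_idem2 x : (forall y, (gdist e x y <= 2)%N) ->
  dual_idem C e x 2 = 1%:M - dual_idem C e x 0 - dual_idem C e x 1.
Proof.
move=> le2; apply/matrixP => i j; rewrite !mxE; case: eqP => [->|] /=.
  by have := le2 j; case: gdist => [|[|[|]]] //=; rewrite ?subr0 ?subrr ?sub0r.
by rewrite !subr0.
Qed.

Lemma dual_idem_eq0 x i : (forall y, (gdist e x y <= 2)%N) -> (2 < i)%N ->
  dual_idem C e x i = 0.
Proof.
move=> le2 i_gt2; apply/matrixP => y z; rewrite !mxE.
by rewrite ltn_eqF ?andbF //; apply: leq_ltn_trans i_gt2.
Qed.

Variables (k a c : nat).
Hypothesis srg_e : srg_params e k a c.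

Lemma adjmx_sqr : A *m A = (a%:R - c%:R) *: A + (k%:R - c%:R)%:M + c%:R *: J.
Proof.
have [eq_k eq_a eq_c] := srg_e; apply/matrixP => x y; rewrite !mxE.
under eq_bigr => z _ do rewrite !mxE -natrM mulnb.
rewrite sum_natr_card (_ : #|_| = #|nbhd e x :&: nbhd e y|); last first.
  by apply: eq_card => z; rewrite !inE unfold_in /= [e y z]sym_e.
have [<-|xy] := eqVneq x y.
  by rewrite setIid eq_k irr_e mulr0 mulr1 add0r subrK.
have [exy|nexy] := boolP (e x y); first by rewrite eq_a // !mulr1 addr0 subrK.
by rewrite eq_c // mulr0 !add0r mulr1.
Qed.

(** The local degree of a neighbour [z] of [x] is the number of common neighbours of the adjacent
    pair [x], [z]. *)
Lemma local_adj_regular x :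
  const_mx 1 *m local_adj C e x = a%:R *: (const_mx 1 : 'rV_#|nbhd e x|).
Proof.
have [_ eq_a _] := srg_e; apply/rowP => j; rewrite !mxE mulr1.
have := enum_valP j; rewrite inE => /eq_a <-.
under eq_bigr => i _ do rewrite !mxE mul1r.
rewrite -(big_enum_val (A := mem (nbhd e x)) (fun z => (e z (enum_val j))%:R)) /=.
rewrite big_mkcond (eq_bigr (fun z => (z \in nbhd e x :&: nbhd e (enum_val j))%:R)).
  by rewrite sum_natr_card; congr (_%:R); apply: eq_card.
by move=> z _; rewrite !inE [e (enum_val j) z]sym_e; case: (e x z).
Qed.
End Idempotents.

(** * Intertwiners and isomorphisms of Terwilliger algebras *)

Section ModuleIso.
Variables (C : fieldType) (n : nat) (e : rel 'I_n).
Implicit Types x y : 'I_n.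

Lemma intertwine_gen_alg (G G' : 'M[C]_n -> Prop) (P : 'M[C]_n) :
  P \in unitmx -> (forall M, G M -> G' (P *m M *m invmx P)) ->
  forall M, gen_alg G M -> gen_alg G' (P *m M *m invmx P).
Proof.
move=> Pu GG' M; elim=> {M} [M /GG' GM||M N _ IM _ IN|b M _ IM|M N _ IM _ IN].
- exact: gen_alg_gen.
- by rewrite mulmx1 mulmxV //; apply: gen_alg_one.
- by rewrite mulmxDr mulmxDl; apply: gen_alg_add.
- by rewrite -scalemxAr -scalemxAl; apply: gen_alg_scale.
- suff -> : P *m (M *m N) *m invmx P = P *m M *m invmx P *m (P *m N *m invmx P).
    exact: gen_alg_mul.
  by rewrite !mulmxA mulmxKV.
Qed.

Lemma intertwine_sym (P M N : 'M[C]_n) :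
  P \in unitmx -> P *m M = N *m P -> invmx P *m N = M *m invmx P.
Proof.
by move=> Pu PM; rewrite -[N](mulmxK Pu) -PM !mulmxA mulVmx // mul1mx.
Qed.

Lemma module_iso_sym x y : module_iso C e x y -> module_iso C e y x.
Proof.
case=> P Pu [PA PE]; exists (invmx P); rewrite ?unitmx_inv //; split.
  exact: intertwine_sym.
by move=> i /PE; apply: intertwine_sym.
Qed.

Lemma module_iso_terwilliger_iso x y : module_iso C e x y -> terwilliger_iso C e x y.
Proof.
case=> P Pu [PA PE].
(* Stated for arbitrary [Q], [u], [v] so that it also applies to [invmx P], which gives
   surjectivity. *)
have conjT (Q : 'M[C]_n) u v : Q \in unitmx -> Q *m adjmx C e = adjmx C e *m Q ->
    (forall i, (i <= diameter e)%N -> Q *m dual_idem C e u i = dual_idem C e v i *m Q) ->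
    forall M, terwilliger e u M -> terwilliger e v (Q *m M *m invmx Q).
  move=> Qu QA QE; apply: intertwine_gen_alg => // M [->|[i le_i ->]].
    by left; rewrite QA mulmxK.
  by right; exists i; rewrite // QE // mulmxK.
exists (fun M => P *m M *m invmx P); split; split.
- exact: conjT.
- by move=> M N _ _; rewrite mulmxDr mulmxDl.
- by move=> b M _; rewrite -scalemxAr -scalemxAl.
- by move=> M N _ _; rewrite !mulmxA mulmxKV.
- by rewrite mulmx1 mulmxV.
- move=> M N _ _ /(congr1 (fun K => invmx P *m K *m P)).
  by rewrite !mulmxA !mulmxKV // !mulVmx // !mul1mx.
- move=> N TN; exists (invmx P *m N *m P).
  2: by rewrite !mulmxA mulmxK // mulmxV // mul1mx.
  have := @conjT (invmx P) y x; rewrite unitmx_inv invmxK; apply=> //.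
    exact: intertwine_sym.
  by move=> i /PE; apply: intertwine_sym.
- by rewrite PA mulmxK.
- by move=> i /PE->; rewrite mulmxK.
Qed.
End ModuleIso.

(** * Cospectral local graphs and intertwiners *)

Section Cospectral.
Variables (C : numClosedFieldType) (n : nat) (e : rel 'I_n).
Implicit Types x y : 'I_n.
Hypotheses (sym_e : symmetric e) (irr_e : irreflexive e).
Local Notation A := (adjmx C e).
Local Notation S := (nbhd_mx C e).

Lemma module_iso_same_spectrum x y :
  module_iso C e x y -> same_spectrum (local_adj C e x) (local_adj C e y).
Proof.
(* Equal vertices are set apart: the diameter may then be 0, leaving no intertwining condition at
   index 1. *)
have [-> //|xy] := eqVneq x y.
case=> P Pu [PA /(_ 1%N (diameter_gt0 e xy))]; rewrite !dual_idem1 // => PS.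
have P'S := intertwine_sym Pu PS.
suff eqL : char_poly (local_adj C e x) = char_poly (local_adj C e y).
  by move=> z; rewrite /spectrum eqL.
apply/esym/(@char_poly_intertwine _ _ _ (S y *m P *m (S x)^T) (S x *m invmx P *m (S y)^T)).
- have -> : S y *m P *m (S x)^T *m (S x *m invmx P *m (S y)^T) =
            S y *m (P *m ((S x)^T *m S x)) *m invmx P *m (S y)^T by rewrite !mulmxA.
  by rewrite PS !mulmxA nbhd_mxK mul1mx mulmxK // nbhd_mxK.
- have -> : S x *m invmx P *m (S y)^T *m (S y *m P *m (S x)^T) =
            S x *m (invmx P *m ((S y)^T *m S y)) *m P *m (S x)^T by rewrite !mulmxA.
  by rewrite P'S !mulmxA nbhd_mxK mul1mx mulmxKV // nbhd_mxK.
- rewrite -!nbhd_mx_adj //.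
  have -> : S y *m A *m (S y)^T *m (S y *m P *m (S x)^T) =
            S y *m A *m ((S y)^T *m S y *m P) *m (S x)^T by rewrite !mulmxA.
  have -> : S y *m P *m (S x)^T *m (S x *m A *m (S x)^T) =
            S y *m (P *m ((S x)^T *m S x)) *m A *m (S x)^T by rewrite !mulmxA.
  rewrite [in RHS]PS -[in LHS]PS !mulmxA nbhd_mxK mul1mx -(mulmxA (S y) P A) PA.
  by rewrite -!mulmxA nbhd_mxK mulmx1.
Qed.

Lemma adjmx_trmxC : A^t* = A.
Proof. by apply/matrixP => i j; rewrite !mxE rmorph_nat sym_e. Qed.

Lemma local_adj_trmxC x : (local_adj C e x)^t* = local_adj C e x.
Proof. by apply/matrixP => i j; rewrite !mxE rmorph_nat sym_e. Qed.

Lemma nbhd_mx_trmxC x : (S x)^t* = (S x)^T.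
Proof. by apply/matrixP => i j; rewrite !mxE rmorph_nat. Qed.

Definition closed_nbhd_mx x : 'M[C]_(1 + #|nbhd e x|, n) := col_mx (delta_mx 0 x) (S x).
Local Notation G := closed_nbhd_mx.

Lemma gram_closed_nbhd_mx x (M : 'M[C]_n) : M^t* = M ->
  G x *m M *m (G x)^t* =
  block_mx (M x x)%:M ((rowsub enum_val (col x M))^t*) (rowsub enum_val (col x M))
           (mxsub enum_val enum_val M).
Proof.
move=> Mstar; have dE : (delta_mx (0 : 'I_1) x)^t* = delta_mx x 0 :> 'M[C]_(n, 1).
  by rewrite trmx_delta map_delta_mx.
rewrite tr_col_mx map_row_mx dE nbhd_mx_trmxC mul_col_mx mul_col_row !mul_mx_nbhdT.
rewrite !mul_nbhd_mx -rowE -!colE; congr block_mx; apply/matrixP => i j; rewrite !mxE.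
- by rewrite !ord1 eqxx.
- by rewrite -[in LHS]Mstar !mxE.
- by [].
- by [].
Qed.

Variables (k a c : nat).
Hypothesis srg_e : srg_params e k a c.

Definition bose_mesner (M : 'M[C]_n) :=
  exists r s t : C, M = r *: A + s *: 1%:M + t *: const_mx 1.

Lemma bose_mesner_mul M : bose_mesner M -> bose_mesner (A *m M).
Proof.
case=> [r [s [t ->]]].
have AJ : A *m const_mx 1 = k%:R *: (const_mx 1 : 'M_n).
  have [eq_k _ _] := srg_e; apply/matrixP => x y; rewrite !mxE mulr1 -(eq_k x).
  under eq_bigr => z _ do rewrite !mxE mulr1.
  by rewrite sum_natr_card; congr (_%:R); apply: eq_card => z; rewrite !inE unfold_in.
exists (r * (a%:R - c%:R) + s), (r * (k%:R - c%:R)), (r * c%:R + t * k%:R).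
rewrite !mulmxDr -!scalemxAr (adjmx_sqr C sym_e irr_e srg_e) mulmx1 AJ.
by apply/matrixP => x y; rewrite !mxE; ring.
Qed.

Section SameSpectrum.
Variables (x y : 'I_n).
Hypothesis eq_xy : same_spectrum (local_adj C e x) (local_adj C e y).

(** Split along [x] and its neighbours, the Gram matrices of [A], [I], [J] consist of constant
    blocks, identities and the local adjacency matrix. [U] is unitary, intertwines the local
    matrices and fixes the all-ones vectors, so all blocks match. *)
Lemma gram_closed_nbhd :
  exists U : 'M[C]_(#|nbhd e x|, #|nbhd e y|),
  U^t* *m U = 1%:M /\ forall M, bose_mesner M ->
  G x *m M *m (G x)^t* = block_mx 1%:M 0 0 U *m G y *m M *m (block_mx 1%:M 0 0 U *m G y)^t*.
Proof.
have [eq_k _ _] := srg_e.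
have [||||||U [UU U'U UL uU]] := @regular_cospectral_unitary C _ _ a%:R
  (local_adj C e x) (local_adj C e y).
- by rewrite !eq_k.
- exact: local_adj_trmxC.
- exact: local_adj_trmxC.
- exact: local_adj_regular srg_e x.
- exact: local_adj_regular srg_e y.
- exact: same_spectrum_char_poly.
exists U; split=> // M [r [s [t ->]]].
set D := block_mx _ _ _ _.
have Dstar : D^t* = block_mx 1%:M 0 0 (U^t*).
  by rewrite tr_block_mx map_block_mx !trmx0 !map_mx0 trmxC1.
have uU' : const_mx 1 *m U^t* = const_mx 1 :> 'rV_#|nbhd e x|.
  by rewrite -uU -mulmxA UU mulmx1.
have Uu : U *m const_mx 1 = const_mx 1 :> 'cV_#|nbhd e x|.
  have := congr1 (fun N => N^t*) uU'; rewrite /= trmxC_mul trmxCK.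
  by rewrite !trmx_const !map_const_mx rmorph1.
have linG m (K : 'M[C]_(m, n)) : K *m (r *: A + s *: 1%:M + t *: const_mx 1) *m K^t* =
    r *: (K *m A *m K^t*) + s *: (K *m 1%:M *m K^t*) + t *: (K *m const_mx 1 *m K^t*).
  by rewrite !mulmxDr !mulmxDl -!scalemxAr -!scalemxAl.
have DG (N : 'M[C]_n) : N^t* = N ->
    D *m (G y *m N *m (G y)^t*) *m D^t* = G x *m N *m (G x)^t* ->
    D *m G y *m N *m (D *m G y)^t* = G x *m N *m (G x)^t*.
  by rewrite trmxC_mul !mulmxA.
have block_const (z : 'I_n) : G z *m const_mx 1 *m (G z)^t* =
   block_mx 1%:M (const_mx 1) (const_mx 1) (const_mx 1).
  rewrite gram_closed_nbhd_mx; last by apply/matrixP => i j; rewrite !mxE rmorph1.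
  by congr block_mx; apply/matrixP => i j; rewrite !mxE ?rmorph1.
have block_one (z : 'I_n) : G z *m 1%:M *m (G z)^t* = block_mx 1%:M 0 0 1%:M.
  rewrite gram_closed_nbhd_mx ?trmxC1 //.
  have -> : rowsub enum_val (col z 1%:M) = 0 :> 'cV[C]_#|nbhd e z|.
    apply/colP => i; rewrite !mxE; have := enum_valP i; rewrite inE.
    by case: eqP => // ->; rewrite irr_e.
  rewrite trmx0 map_mx0; congr block_mx; apply/matrixP => i j; rewrite !mxE ?eqxx //.
  by rewrite (inj_eq enum_val_inj).
have block_adj (z : 'I_n) : G z *m A *m (G z)^t* =
    block_mx 0 (const_mx 1) (const_mx 1) (local_adj C e z).
  have adjz (i : 'I_#|nbhd e z|) : e z (enum_val i) by have := enum_valP i; rewrite inE.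
  rewrite gram_closed_nbhd_mx ?adjmx_trmxC //; congr block_mx.
  - by apply/matrixP => i j; rewrite !mxE irr_e mul0rn.
  - by apply/matrixP => i j; rewrite !mxE sym_e adjz rmorph1.
  - by apply/matrixP => i j; rewrite !mxE sym_e adjz.
  - by apply/matrixP => i j; rewrite !mxE.
rewrite !linG; congr (_ *: _ + _ *: _ + _ *: _); apply/esym/DG.
- exact: adjmx_trmxC.
- rewrite !block_adj Dstar !mulmx_block.
  rewrite !(mul0mx, mulmx0, mul1mx, mulmx1, addr0, add0r) uU' Uu.
  by rewrite UL -mulmxA UU mulmx1.
- exact: trmxC1.
- rewrite !block_one Dstar !mulmx_block.
  by rewrite !(mul0mx, mulmx0, mul1mx, mulmx1, addr0, add0r) UU.
- by apply/matrixP => i j; rewrite !mxE rmorph1.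
- rewrite !block_const Dstar !mulmx_block.
  rewrite !(mul0mx, mulmx0, mul1mx, mulmx1, addr0, add0r) uU' Uu.
  have constM p q : (const_mx 1 : 'cV[C]_p) *m (const_mx 1 : 'rV_q) = const_mx 1.
    by apply/matrixP => i j; rewrite !mxE big_ord1 !mxE mulr1.
  by rewrite -[X in U *m X *m _]constM mulmxA Uu -mulmxA uU' constM.
Qed.

Lemma same_spectrum_module_iso : (forall u v, (gdist e u v <= 2)%N) ->
  module_iso C e x y.
Proof.
(* Right multiplication by the extension carries rows at [x] to rows at [y]; on columns it goes from
   [y] to [x], hence the symmetry. *)
move=> le2; apply: module_iso_sym; have [U [U'U gramU]] := gram_closed_nbhd.
have [|||P Pu [PA]] := gram_extension_comm adjmx_trmxC (V := bose_mesner)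
  _ _ _ bose_mesner_mul gramU.
- by exists 0, 1, 0; rewrite !scale0r scale1r add0r addr0.
- move=> M N [r [s [t ->]]] [r' [s' [t' ->]]].
  exists (r + r'), (s + s'), (t + t'); rewrite !scalerDl addrACA; congr (_ + _).
  by rewrite addrACA.
- move=> b M [r [s [t ->]]]; exists (b * r), (b * s), (b * t).
  by rewrite !scalerDr !scalerA.
rewrite /G mul_block_col !mul0mx addr0 add0r mul1mx mul_col_mx => /eq_col_mx[dP SP].
rewrite !tr_col_mx !map_row_mx mul_mx_row => /eq_row_mx[Pd PS].
exists P => //; split=> //.
(* Each of the first two dual idempotents is an adjoint times a matrix of unit rows, and each factor
   uses one of the two equations of the extension. *)
have PE0 : P *m dual_idem C e y 0 = dual_idem C e x 0 *m P.
  have dE z : (delta_mx (0 : 'I_1) z)^t* = delta_mx z 0 :> 'M[C]_(n, 1).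
    by rewrite trmx_delta map_delta_mx.
  rewrite !dual_idem0 -(mul_delta_mx (0 : 'I_1) y y) -(mul_delta_mx (0 : 'I_1) x x).
  by move: Pd; rewrite !dE mulmxA => ->; rewrite -[RHS]mulmxA dP.
have PE1 : P *m dual_idem C e y 1 = dual_idem C e x 1 *m P.
  rewrite !dual_idem1 // mulmxA -nbhd_mx_trmxC.
  have -> : P *m (S y)^t* = (S x)^t* *m U.
    by rewrite -PS trmxC_mul -!mulmxA U'U mulmx1.
  by rewrite -mulmxA -SP nbhd_mx_trmxC mulmxA.
(* Distances are at most 2, so the idempotent at 2 is the complement of the first two and later ones
   vanish. *)
move=> [|[|[|i]]] _ //.
  by rewrite !dual_idem2 // !mulmxBr !mulmxBl mulmx1 mul1mx PE0 PE1.
by rewrite !dual_idem_eq0 // mulmx0 mul0mx.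
Qed.
End SameSpectrum.
End Cospectral.

Theorem theorem5p11 (R : realType) (n : nat) (e : rel 'I_n) :
  is_srg e -> connected_graph e ->
  (pseudo_vertex_transitive R[i] e <->
   forall x y : 'I_n,
     same_spectrum (local_adj R[i] e x) (local_adj R[i] e y)).
Proof.
move=> srg_e conn_e.
have [[sym_e irr_e] [k [a [c params_e]]]] := srg_e; split=> [pvt x y|eq_spec x y].
  by apply: module_iso_same_spectrum => //; have [] := pvt x y.
have iso_xy : module_iso R[i] e x y.
  by apply: (same_spectrum_module_iso sym_e irr_e params_e) => // u v; apply: srg_gdist_le2.
by split=> //; apply: module_iso_terwilliger_iso.
Qed.
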